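(* Let $M,N,\tau_p$ be positive integers, let $\overline{\mathbf{R}}_{\rm g'}\in\mathbb{C}^{M\times M}$ and $\overline{\mathbf{R}}_{\rm h},\overline{\mathbf{R}}_{\rm g}\in\mathbb{C}^{N\times N}$ be non-zero correlation matrices (Hermitian positive semi-definite) with $\overline{\mathbf{R}}_{\rm h}\odot\overline{\mathbf{R}}_{\rm g}\neq\mathbf 0$, and let $\overline r_{\rm g'}=\mathrm{rank}(\overline{\mathbf{R}}_{\rm g'})$ and $\overline r_{\rm hg}=\mathrm{rank}(\overline{\mathbf{R}}_{\rm h}\odot\overline{\mathbf{R}}_{\rm g})$, with $\tau_p\ge\overline r_{\rm hg}$. Let the columns of $\overline{\mathbf{U}}_{{\rm g'},1}\in\mathbb{C}^{M\times\overline r_{\rm g'}}$ and $\overline{\mathbf{U}}_{{\rm hg},1}\in\mathbb{C}^{N\times\overline r_{\rm hg}}$ be orthonormal eigenvectors of $\overline{\mathbf{R}}_{\rm g'}$ and $\overline{\mathbf{R}}_{\rm h}\odot\overline{\mathbf{R}}_{\rm g}$, respectively, corresponding to the non-zero eigenvalues, and put $\overline{\mathbf{U}}_{\rm x,1}=\overline{\mathbf{U}}_{{\rm g'},1}\otimes\overline{\mathbf{U}}_{{\rm hg},1}$. Consider the problem $$\underset{\mathrm{tr}(\mathbf{\Phi}^{\rm H}\mathbf{\Phi})\le N\tau_p}{\mathrm{minimize}}\ \ \mathrm{tr}\left(\left(\overline{\mathbf{U}}_{\rm x,1}^{\rm H}\mathbf{\Phi}_M^{\rm H}\mathbf{\Phi}_M\overline{\mathbf{U}}_{\rm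 x,1}\right)^{-1}\right),\qquad \mathbf{\Phi}_M=\mathbf{I}_M\otimes\mathbf{\Phi},$$ over $\mathbf{\Phi}\in\mathbb{C}^{\tau_p\times N}$ such that $\mathbf{\Phi}\overline{\mathbf{U}}_{{\rm hg},1}$ has full column rank $\overline r_{\rm hg}$. Then for any matrix $\mathbf{S}_{\Phi,1}\in\mathbb{C}^{\tau_p\times\overline r_{\rm hg}}$ with orthonormal columns, $$\mathbf{\Phi}^{\star}=\sqrt{\frac{N\tau_p}{\overline r_{\rm hg}}}\,\mathbf{S}_{\Phi,1}\overline{\mathbf{U}}_{{\rm hg},1}^{\rm H}$$ is an optimal solution.
   Context: $\otimes$ is the Kronecker product, $\odot$ the Hadamard (entrywise) product, and $^{\rm H}$ the conjugate transpose. Up to the factor $1/\mathrm{SNR}$, the objective is the mean-square error of the reduced-subspace least squares channel estimator in the absence of interference. *)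

(* Defs.v *)
From mathcomp Require Import all_boot all_order all_algebra.
From mathcomp Require Import sesquilinear spectral.
From mathcomp.real_closed Require Import complex mxtens.
From mathcomp Require Import reals.

Set Implicit Arguments.
Unset Strict Implicit.
Unset Printing Implicit Defensive.

Import Order.TTheory GRing.Theory Num.Theory.
Local Open Scope ring_scope.
Local Open Scope sesquilinear_scope.

Section Defs.
Context {C : numClosedFieldType}.

(* On a numClosedFieldType, x <= y holds iff y - x is real and nonnegative;
   in particular 0 <= x asserts that x is real. *)

Definition hermitian_psd n (A : 'M[C]_n) : Prop :=
  A \is hermsymmx /\ forall x : 'cV[C]_n, 0 <= (x^t* *m A *m x) 0 0.

Definition hadamard m n (A B : 'M[C]_(m, n)) : 'M[C]_(m, n) := map2_mx *%R A B.

(* [unitarymx] constrains rows instead (X *m X ^t* = 1). *)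
Definition orthonormal_cols m n (U : 'M[C]_(m, n)) : Prop := U^t* *m U = 1%:M.

(* Eigenvectors are columns here, whereas [eigenspace] is about row vectors.
   Columns of U are nonzero by orthonormality. *)
Definition nonzero_eigenvectors n r (A : 'M[C]_n) (U : 'M[C]_(n, r)) : Prop :=
  orthonormal_cols U /\
  forall j : 'I_r, exists2 l : C, l != 0 & A *m col j U = l *: col j U.

Section Problem.
Variables (M N tau rg' rhg : nat).
Variables (Ug' : 'M[C]_(M, rg')) (Uhg : 'M[C]_(N, rhg)).

Definition feasible (Phi : 'M[C]_(tau, N)) : Prop :=
  \tr (Phi^t* *m Phi) <= (N * tau)%:R /\ \rank (Phi *m Uhg) = rhg.

(* [invmx] is the identity on singular matrices, but the rank condition of
   [feasible] makes the matrix below invertible as soon as the columns of Ug'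
   are orthonormal. *)
Definition mse (Phi : 'M[C]_(tau, N)) : C :=
  let Ux := Ug' *t Uhg in
  let PhiM := (1%:M : 'M[C]_M) *t Phi in
  \tr (invmx (Ux^t* *m PhiM^t* *m PhiM *m Ux)).

Definition optimal (Phi : 'M[C]_(tau, N)) : Prop :=
  feasible Phi /\ forall Psi, feasible Psi -> mse Phi <= mse Psi.

End Problem.
End Defs.

(* Main.v *)
(** With [G = (Phi U)^t* (Phi U)] the objective factors as [rg' * \tr G^-1],
    and [\tr G] is at most the power [\tr (Phi^t* Phi) <= N tau] because
    [U U^t*] is an orthogonal projection. Then [\tr G^-1 >= rhg^2 / (N tau)]
    is the Cauchy-Schwarz inequality for the Frobenius inner product of
    [Phi U] and [Phi U G^-1], whose value is [\tr 1%:M = rhg]; equality holds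
    when [G] is scalar with trace [N tau], as for the proposed solution. *)
Require Import Defs.
From mathcomp Require Import all_boot all_order all_algebra.
From mathcomp Require Import sesquilinear spectral reals.
From mathcomp.real_closed Require Import complex mxtens.
From mathcomp Require Import ring.

Set Implicit Arguments.
Unset Strict Implicit.
Unset Printing Implicit Defensive.

Import Order.TTheory GRing.Theory Num.Theory.
Local Open Scope ring_scope.
Local Open Scope sesquilinear_scope.

Lemma invmx_uniq (F : fieldType) n (A B : 'M[F]_n) : A *m B = 1%:M -> invmx A = B.
Proof.
move=> AB1; have [uA _] := mulmx1_unit AB1.
by rewrite -[B](mulKmx uA) AB1 mulmx1.
Qed.

Lemma trace_tensmx (R : comPzRingType) m n (A : 'M[R]_m) (B : 'M[R]_n) :
  \tr (A *t B) = \tr A * \tr B.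
Proof.
rewrite /mxtrace mulr_sum; apply: eq_bigr => k _.
by case: (mxtens_indexP k) => i j; rewrite tensmxE mxtens_indexK.
Qed.

Lemma tens_mx1 (R : pzRingType) m n : 1%:M *t 1%:M = 1%:M :> 'M[R]_(m * n).
Proof.
apply/matrixP => k l.
case: (mxtens_indexP k) => i j; case: (mxtens_indexP l) => i' j'.
rewrite tensmxE !mxE (can_eq (@mxtens_indexK m n)) xpair_eqE.
by rewrite mulr_natl -mulrnA mulnb andbC.
Qed.

Lemma invmx_tens (F : fieldType) m n (A : 'M[F]_m) (B : 'M[F]_n) :
  A \in unitmx -> B \in unitmx -> invmx (A *t B) = invmx A *t invmx B.
Proof.
move=> uA uB; apply: invmx_uniq.
by rewrite tensmx_mul !mulmxV // tens_mx1.
Qed.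

Section Gram.
Context {C : numClosedFieldType}.

Lemma adjmxM m n p (A : 'M[C]_(m, n)) (B : 'M[C]_(n, p)) :
  (A *m B)^t* = B^t* *m A^t*.
Proof. by rewrite trmx_mul map_mxM. Qed.

Lemma adjmxZ m n (a : C) (A : 'M[C]_(m, n)) : (a *: A)^t* = a^* *: A^t*.
Proof. by rewrite linearZ map_mxZ. Qed.

Lemma adjmxB m n (A B : 'M[C]_(m, n)) : (A - B)^t* = A^t* - B^t*.
Proof. by rewrite linearB map_mxB. Qed.

Lemma adjmx_tens m n p q (A : 'M[C]_(m, n)) (B : 'M[C]_(p, q)) :
  (A *t B)^t* = A^t* *t B^t*.
Proof. by rewrite trmx_tens map_mxT. Qed.

Lemma trace_gramE m n (A : 'M[C]_(m, n)) :
  \tr (A^t* *m A) = \sum_j \sum_i `|A i j| ^+ 2.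
Proof.
apply: eq_bigr => j _; rewrite mxE; apply: eq_bigr => i _.
by rewrite !mxE normCKC.
Qed.

Lemma trace_gram_ge0 m n (A : 'M[C]_(m, n)) : 0 <= \tr (A^t* *m A).
Proof.
by rewrite trace_gramE; do 2!apply: sumr_ge0 => ? _; rewrite exprn_ge0.
Qed.

Lemma gram_eq0 m n (A : 'M[C]_(m, n)) : A^t* *m A = 0 -> A = 0.
Proof.
move=> A0; have: \tr (A^t* *m A) = 0 by rewrite A0 mxtrace0.
have ge0 i j : 0 <= `|A i j| ^+ 2 by rewrite exprn_ge0.
rewrite trace_gramE => /psumr_eq0P tr0; apply/matrixP => i j; rewrite mxE.
have /psumr_eq0P colj0 : \sum_i `|A i j| ^+ 2 = 0.
  by apply: tr0 => // k _; apply: sumr_ge0.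
by apply/eqP; rewrite -normr_eq0 -sqrf_eq0 colj0.
Qed.

(** If a row [v] kills the Gram matrix, then [v *m A^t* *m A *m v^t* = 0] is the Gram matrix of
    [A *m v^t*], so [A *m v^t* = 0]; full column rank of [A], read as row freeness of [A^t*], then
    forces [v = 0]. *)
Lemma gram_unitmx m n (A : 'M[C]_(m, n)) :
  \rank A = n -> A^t* *m A \in unitmx.
Proof.
move=> rkA; rewrite -row_free_unit; apply: inj_row_free => v vG0.
have rfA : row_free (A^t*).
  by rewrite /row_free mxrank_map mxrank_tr rkA.
suff /(congr1 (fun X => X^t*)): A *m v^t* = 0.
  rewrite adjmxM trmxCK trmx0 map_mx0 => vA0.
  by apply/eqP; rewrite -(mulmx_free_eq0 _ rfA) vA0.
by apply: gram_eq0; rewrite adjmxM trmxCK mulmxA -(mulmxA v) vG0 mul0mx.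
Qed.

(** The gap between the two sides is the squared Frobenius norm of [A - A *m U *m U^t*], the part of
    [A] acting on the orthogonal complement of the range of [U]. *)
Lemma trace_gram_isometry m n r (A : 'M[C]_(m, n)) (U : 'M[C]_(n, r)) :
  orthonormal_cols U ->
  \tr ((A *m U)^t* *m (A *m U)) <= \tr (A^t* *m A).
Proof.
move=> UU; rewrite -subr_ge0.
have := trace_gram_ge0 (A - A *m U *m U^t*).
congr (0 <= _).
rewrite adjmxB !adjmxM trmxCK mulmxBl !mulmxBr !linearB /=.
have -> : \tr (A^t* *m (A *m U *m U^t*)) = \tr (U^t* *m A^t* *m (A *m U)).
  by rewrite !mulmxA mxtrace_mulC !mulmxA.
have -> : U *m (U^t* *m A^t*) *m (A *m U *m U^t*) =
          U *m (U^t* *m A^t* *m (A *m U)) *m U^t* by rewrite !mulmxA.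
rewrite (mxtrace_mulC _ (U^t*)) [U^t* *m (U *m _)]mulmxA UU mul1mx.
rewrite -[U *m _ *m A]mulmxA (mxtrace_mulC U).
by rewrite -[_ *m A *m U]mulmxA subrr subr0.
Qed.

Lemma trace_inv_gram_ge m r (A : 'M[C]_(m, r)) (b : C) :
    \rank A = r -> 0 < b -> \tr (A^t* *m A) <= b ->
  r%:R ^+ 2 / b <= \tr (invmx (A^t* *m A)).
Proof.
move=> /gram_unitmx; set G := A^t* *m A => uG b_gt0 trG.
have GH : (invmx G)^t* = invmx G.
  by rewrite trmx_inv map_invmx /G adjmxM trmxCK.
set c : C := r%:R / b.
have c_ge0 : 0 <= c by rewrite divr_ge0 ?ler0n // ltW.
have cJ : c^* = c by rewrite geC0_conj.
(* Cauchy-Schwarz by completing the square, with [c] tuned to [\tr G = b]. *)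
have := trace_gram_ge0 (c *: A - A *m invmx G).
rewrite adjmxB adjmxZ adjmxM cJ GH mulmxBl !mulmxBr -!scalemxAl -!scalemxAr.
rewrite -[invmx G *m A^t* *m A]mulmxA -[invmx G *m A^t* *m _]mulmxA.
rewrite ![A^t* *m (A *m _)]mulmxA -/G mulmxV // mulVmx // mulmx1.
rewrite !linearB !linearZ /= mxtrace1 => sq_ge0.
have cb : c * b = r%:R by rewrite mulfVK // gt_eqF.
(* In this form the bound matches the expanded square term by term, with [b] in place of [\tr G];
   the slack left over is [c * c * (b - \tr G)]. *)
have -> : r%:R ^+ 2 / b = c * r%:R *+ 2 - c * (c * b).
  by rewrite cb /c; field; rewrite gt_eqF.
rewrite -subr_ge0; apply: (le_trans sq_ge0).
rewrite -subr_ge0.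
set t := \tr (invmx G); set g := \tr G.
have -> : t - (c * r%:R *+ 2 - c * (c * b)) -
          (c * (c * g) - c * r%:R - (c * r%:R - t)) = c * c * (b - g) by ring.
by apply: mulr_ge0; [exact: mulr_ge0 | rewrite subr_ge0].
Qed.

(** By the mixed-product rule the matrix to invert is [1%:M *t G], with [G] the Gram matrix of
    [Phi *m U]; the rank hypothesis makes [G] invertible, and the identity factor contributes [r] to
    the trace. *)
Lemma mseE M N tau r s (V : 'M[C]_(M, r)) (U : 'M[C]_(N, s))
    (Phi : 'M[C]_(tau, N)) :
    orthonormal_cols V -> \rank (Phi *m U) = s ->
  mse V U Phi = r%:R * \tr (invmx ((Phi *m U)^t* *m (Phi *m U))).
Proof.
move=> VV rk; rewrite /mse !adjmx_tens !tensmx_mul trmx1 map_mx1 !mulmx1.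
rewrite VV invmx_tens ?unitmx1 //; last first.
  by have := gram_unitmx rk; rewrite adjmxM !mulmxA.
by rewrite trace_tensmx invmx1 mxtrace1 adjmxM !mulmxA.
Qed.

(** Both inequalities are tight here: this matrix vanishes on the orthogonal complement of the range
    of [U], and its product with [U] has a scalar Gram matrix of trace [N * tau]. *)
Lemma scaled_isometry_optimal M N tau r s (V : 'M[C]_(M, r))
    (U : 'M[C]_(N, s)) (S : 'M[C]_(tau, s)) :
    (0 < N)%N -> (0 < tau)%N -> (0 < s)%N ->
    orthonormal_cols V -> orthonormal_cols U -> orthonormal_cols S ->
  optimal V U (sqrtC ((N * tau)%:R / s%:R) *: (S *m U^t*)).
Proof.
move=> N_gt0 tau_gt0 s_gt0 VV UU SS.
have b_gt0 : 0 < (N * tau)%:R :> C by rewrite ltr0n muln_gt0 N_gt0.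
set b : C := (N * tau)%:R in b_gt0 *.
have sC_gt0 : 0 < s%:R :> C by rewrite ltr0n.
set a := sqrtC _; set Phi := a *: _.
have a_ge0 : 0 <= a by rewrite sqrtC_ge0 divr_ge0 // ltW.
have aa : a^* * a = b / s%:R by rewrite geC0_conj // -expr2 sqrtCK.
have PhiU : Phi *m U = a *: S by rewrite -scalemxAl -mulmxA UU mulmx1.
have gramS : (a *: S)^t* *m (a *: S) = (b / s%:R)%:M.
  by rewrite adjmxZ -scalemxAl -scalemxAr scalerA aa SS scalemx1.
have rkPhi : \rank (Phi *m U) = s.
  apply/eqP; rewrite eqn_leq rank_leq_col PhiU.
  (* The Gram matrix is a non-zero scalar matrix, hence of rank [s], and a product has at most the
     rank of its right factor. *)
  have := mxrankM_maxr ((a *: S)^t*) (a *: S).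
  rewrite gramS mxrank_unit // -scalemx1 unitmxZ ?unitmx1 //.
  by rewrite unitfE gt_eqF ?divr_gt0.
split=> [|Psi [trPsi rkPsi]].
  (* The power budget is spent exactly: the trace is [b / s%:R] times [\tr (U^t* *m U) = s%:R]. *)
  split=> //; rewrite /Phi adjmxZ -scalemxAl -scalemxAr scalerA aa.
  rewrite adjmxM trmxCK -mulmxA (mulmxA (S^t*)) SS mul1mx mxtraceZ.
  by rewrite mxtrace_mulC UU mxtrace1 mulfVK // gt_eqF.
rewrite !mseE // ler_wpM2l ?ler0n // PhiU gramS invmx_scalar mxtrace_scalar.
have -> : (b / s%:R)^-1 *+ s = s%:R ^+ 2 / b.
  by rewrite -(mulr_natr _^-1); rewrite invf_div mulrAC expr2.
apply: trace_inv_gram_ge => //; apply: le_trans trPsi.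
exact: trace_gram_isometry.
Qed.

End Gram.

Local Open Scope complex_scope.

Theorem mainTheorem2 (R : realType) (M N tau : nat)
    (M_gt0 : (0 < M)%N) (N_gt0 : (0 < N)%N) (tau_gt0 : (0 < tau)%N)
    (Rg' : 'M[R[i]]_M) (Rh Rg : 'M[R[i]]_N)
    (Rg'_psd : hermitian_psd Rg') (Rh_psd : hermitian_psd Rh)
    (Rg_psd : hermitian_psd Rg)
    (Rg'_neq0 : Rg' != 0) (Rh_neq0 : Rh != 0) (Rg_neq0 : Rg != 0)
    (Rhg_neq0 : hadamard Rh Rg != 0)
    (rg' rhg : nat)
    (rg'E : rg' = \rank Rg') (rhgE : rhg = \rank (hadamard Rh Rg))
    (le_rhg_tau : (rhg <= tau)%N)
    (Ug' : 'M[R[i]]_(M, rg')) (Uhg : 'M[R[i]]_(N, rhg))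
    (Ug'P : nonzero_eigenvectors Rg' Ug')
    (UhgP : nonzero_eigenvectors (hadamard Rh Rg) Uhg)
    (S : 'M[R[i]]_(tau, rhg)) (SP : orthonormal_cols S) :
  optimal Ug' Uhg (sqrtC ((N * tau)%:R / rhg%:R) *: (S *m Uhg^t*)).
Proof.
case: Ug'P UhgP => VV _ [UU _]; apply: scaled_isometry_optimal => //.
(* A non-zero Hadamard product has positive rank, so the scale factor divides by a non-zero
   number. *)
by rewrite rhgE lt0n mxrank_eq0.
Qed.
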